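(* Let $1\leq p<n$. If $f\colon\mathbb{B}^n\to\mathbb{R}$ has $(p+1)$-permutable lattice derivatives, then $f$ has $p$-permutable lattice derivatives.
   Context: $\mathbb{B}=\{0,1\}$, $[n]=\{1,\dots,n\}$. For $k\in[n]$, $\mathbf{x}\in\mathbb{B}^n$, $a\in\mathbb{B}$, $\mathbf{x}_k^a$ is the tuple obtained from $\mathbf{x}$ by replacing its $k$-th component by $a$. The lattice derivatives are $\wedge_kf,\vee_kf\colon\mathbb{B}^n\to\mathbb{R}$, $\wedge_kf(\mathbf{x})=\min(f(\mathbf{x}_k^0),f(\mathbf{x}_k^1))$, $\vee_kf(\mathbf{x})=\max(f(\mathbf{x}_k^0),f(\mathbf{x}_k^1))$. For $q\in[n]$, $f$ has $q$-permutable lattice derivatives if for every $q$-subset $\{k_1,\dots,k_q\}\subseteq[n]$, every choice of operators $O_{k_i}\in\{\wedge_{k_i},\vee_{k_i}\}$ ($i=1,\dots,q$) and every permutation $\pi$ of $\{1,\dots,q\}$, we have $O_{k_1}\cdots O_{k_q}f=O_{k_{\pi(1)}}\cdots O_{k_{\pi(q)}}f$ (operators applied right to left). *)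

(* Defs.v *)
From mathcomp Require Import all_boot all_order all_fingroup all_algebra.
From mathcomp Require Import reals.

Set Implicit Arguments.
Unset Strict Implicit.
Unset Printing Implicit Defensive.

Import Order.TTheory GRing.Theory Num.Theory.

Local Open Scope ring_scope.

(* The coordinates 1, ..., n of a Boolean tuple are indexed from 0 by 'I_n. *)
Definition cube (n : nat) := {ffun 'I_n -> bool}.

Definition subst_at (n : nat) (x : cube n) (k : 'I_n) (a : bool) : cube n :=
  [ffun i => if i == k then a else x i].

Section LatticeDerivatives.

Variables (R : realType) (n : nat).
Implicit Type f : cube n -> R.

Definition meet_deriv (k : 'I_n) f : cube n -> R :=
  fun x => Num.min (f (subst_at x k false)) (f (subst_at x k true)).

Definition join_deriv (k : 'I_n) f : cube n -> R :=
  fun x => Num.max (f (subst_at x k false)) (f (subst_at x k true)).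

Inductive lattice_op := Meet | Join.

Definition lattice_deriv (o : lattice_op) : 'I_n -> (cube n -> R) -> cube n -> R :=
  match o with Meet => meet_deriv | Join => join_deriv end.

(* O_{k_1} (O_{k_2} ( ... (O_{k_q} f))), where O_{k_i} is the derivative of
   kind o i with respect to the variable k i. *)
Definition iter_lattice_deriv (q : nat) (k : 'I_q -> 'I_n)
    (o : 'I_q -> lattice_op) f : cube n -> R :=
  foldr (fun i g => lattice_deriv (o i) (k i) g) f (enum 'I_q).

(* A q-subset {k_1, ..., k_q} of the variables is given by an injective
   enumeration k; equality of functions is pointwise. *)
Definition permutable_lattice_derivs (q : nat) f : Prop :=
  forall (k : 'I_q -> 'I_n) (o : 'I_q -> lattice_op) (s : 'S_q),
    injective k ->
    iter_lattice_deriv k o f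
      =1 iter_lattice_deriv (fun i => k (s i)) (fun i => o (s i)) f.

End LatticeDerivatives.

(* Main.v *)
Require Import Defs.
From mathcomp Require Import all_boot all_order all_fingroup all_algebra.
From mathcomp Require Import reals.

(** Exchanging two adjacent operators in [O_1 ... O_p f] gives functions [g] and
[h] that are comparable: [min] and [min] commute, [max] and [max] commute, and
max-min is at most min-max, while the operators applied afterwards are monotone.
For a variable [k] that is not used, [(p+1)]-permutability yields
[min_k g = min_k h] and [max_k g = max_k h], so [g] and [h] have the same sum
over the two values of [x_k]; being comparable, they are equal. *)

Set Implicit Arguments.
Unset Strict Implicit.
Unset Printing Implicit Defensive.

Import Order.TTheory GRing.Theory Num.Theory.

Local Open Scope ring_scope.

(** Each of the two minima shares an entry with each of the two maxima. *)
Lemma max_min_le_min_max d (T : orderType d) (a b a' b' : T) :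
  (Order.max (Order.min a b) (Order.min a' b')
     <= Order.min (Order.max a a') (Order.max b b'))%O.
Proof. by rewrite ge_max !le_min !le_max !ge_min !lexx !orbT. Qed.

Lemma eq_pair_of_minmax (R : realDomainType) (a b c d : R) :
  a <= c -> b <= d -> Num.min a b = Num.min c d -> Num.max a b = Num.max c d ->
  a = c /\ b = d.
Proof.
move=> ac bd Emin Emax.
have E : a + b = c + d by rewrite -addr_min_max Emin Emax addr_min_max.
split; apply/eqP; rewrite eq_le ?ac ?bd /=.
  by rewrite -(lerD2r b) E lerD2l.
by rewrite -(lerD2l a) E lerD2r.
Qed.

Lemma subst_atC n (x : cube n) k l a b : k != l ->
  subst_at (subst_at x k a) l b = subst_at (subst_at x l b) k a.
Proof.
move=> kl; apply/ffunP => i; rewrite !ffunE.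
by case: (eqVneq i l) => [->|//]; rewrite eq_sym (negPf kl).
Qed.

Lemma subst_at_id n (x : cube n) k : subst_at x k (x k) = x.
Proof. by apply/ffunP => i; rewrite ffunE; case: eqP => [->|]. Qed.

Section SeqDerivatives.

Variables (R : realType) (n : nat).
Implicit Types (f g h : cube n -> R) (w : 'I_n -> lattice_op) (l : seq 'I_n).

Lemma lattice_deriv_mono o k f g : (forall x, f x <= g x) ->
  forall x, lattice_deriv o k f x <= lattice_deriv o k g x.
Proof.
move=> fg x; case: o; rewrite /= /meet_deriv /join_deriv.
  by rewrite le_min !ge_min !fg orbT.
by rewrite ge_max !le_max !fg orbT.
Qed.

Lemma lattice_deriv_comparable o o' k k' f : k != k' ->
  (forall x, lattice_deriv o k (lattice_deriv o' k' f) x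
               <= lattice_deriv o' k' (lattice_deriv o k f) x) \/
  (forall x, lattice_deriv o' k' (lattice_deriv o k f) x
               <= lattice_deriv o k (lattice_deriv o' k' f) x).
Proof.
move=> kk'; case: o; case: o'; rewrite /= /meet_deriv /join_deriv.
- by left=> x; rewrite !(subst_atC _ _ _ kk') minACA.
- by right=> x; rewrite !(subst_atC _ _ _ kk') max_min_le_min_max.
- by left=> x; rewrite !(subst_atC _ _ _ kk') max_min_le_min_max.
- by left=> x; rewrite !(subst_atC _ _ _ kk') maxACA.
Qed.

Lemma eq_of_lattice_derivs k g h : (forall x, g x <= h x) ->
  (forall o, lattice_deriv o k g =1 lattice_deriv o k h) -> g =1 h.
Proof.
move=> gh E x; rewrite -(subst_at_id x k).
have [E0 E1] := eq_pair_of_minmax (gh _) (gh _) (E Meet x) (E Join x).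
by case: (x k).
Qed.

(** Kinds are attached to variables, not to positions, so that reordering the operators is just
    permuting the list [l]. *)
Definition seq_deriv w l f : cube n -> R :=
  foldr (fun k => lattice_deriv (w k) k) f l.

Lemma seq_deriv_cat w l l' f :
  seq_deriv w (l ++ l') f = seq_deriv w l (seq_deriv w l' f).
Proof. exact: foldr_cat. Qed.

Lemma eq_seq_deriv w w' l f : {in l, w =1 w'} ->
  seq_deriv w l f = seq_deriv w' l f.
Proof.
elim: l => //= k l IH E; rewrite E ?mem_head // IH // => j jl.
by apply: E; rewrite inE jl orbT.
Qed.

Lemma seq_deriv_mono w l f g : (forall x, f x <= g x) ->
  forall x, seq_deriv w l f x <= seq_deriv w l g x.
Proof. by move=> fg; elim: l => //= k l IH; apply: lattice_deriv_mono. Qed.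

Definition seq_permutable q f := forall w l l',
  uniq l -> size l = q -> perm_eq l l' -> seq_deriv w l f =1 seq_deriv w l' f.

Lemma iter_lattice_derivE q (k : 'I_q -> 'I_n) (o : 'I_q -> lattice_op) w f :
  (forall i, w (k i) = o i) ->
  iter_lattice_deriv k o f = seq_deriv w (map k (enum 'I_q)) f.
Proof.
move=> wk; rewrite /iter_lattice_deriv /seq_deriv foldr_map.
by elim: (enum _) => //= i s ->; rewrite wk.
Qed.

Lemma permutable_lattice_derivsP q f :
  permutable_lattice_derivs q f <-> seq_permutable q f.
Proof.
split=> [perm_f w l l' ul sl | perm_f k o s injk].
  move/eqP: sl => sl; rewrite perm_sym => pl.
  have sl' : size l' == q by rewrite (perm_size pl).
  have /tuple_permP[s /= El'] : perm_eq (Tuple sl') (Tuple sl) by [].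
  pose k := tnth (Tuple sl).
  have injk : injective k by apply/tuple_uniqP.
  have El : l = map k (enum 'I_q) by rewrite map_tnth_enum.
  rewrite El El' -(@iter_lattice_derivE _ k (w \o k)) //.
  rewrite -(@iter_lattice_derivE _ (k \o s) (w \o (k \o s))) //.
  exact: perm_f.
(* Injectivity of [k] lets each kind [o i] be carried over to the variable [k i]; [Meet] is an
   arbitrary default off the image of [k]. *)
pose w j := if [pick i | k i == j] is Some i then o i else Meet.
have wk i : w (k i) = o i.
  by rewrite /w; case: pickP => [j /eqP/injk ->|/(_ i)]; rewrite ?eqxx.
rewrite (iter_lattice_derivE _ wk).
rewrite (@iter_lattice_derivE _ _ _ w) => [|i]; last exact: wk.
apply: perm_f.
- by rewrite map_inj_uniq ?enum_uniq.
- by rewrite size_map size_enum_ord.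
- rewrite (map_comp k s) perm_map //.
  apply: uniq_perm; rewrite ?(map_inj_uniq (@perm_inj _ s)) -?enumT ?enum_uniq //.
  move=> i; rewrite mem_enum; symmetry; apply/mapP.
  by exists ((s^-1)%g i); rewrite ?mem_enum ?permKV.
Qed.

Section Step.

Variables (p : nat) (f : cube n -> R).
Hypotheses (hpn : (p < n)%N) (perm_f : seq_permutable p.+1 f).

Lemma seq_deriv_eq_of_le w l l' : uniq l -> size l = p -> perm_eq l l' ->
  (forall x, seq_deriv w l f x <= seq_deriv w l' f x) ->
  seq_deriv w l f =1 seq_deriv w l' f.
Proof.
move=> ul sl pl le.
(* A list of length [p < n] cannot contain all [n] variables. *)
have [k kl] : exists k, k \notin l.
  apply/existsP; rewrite -negb_forall; apply/negP => /forallP sub.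
  have : (size (enum 'I_n) <= size l)%N by apply: uniq_leq_size (enum_uniq _) _.
  by rewrite size_enum_ord sl leqNgt hpn.
apply: (eq_of_lattice_derivs (k := k)) => // o.
(* Giving the fresh variable [k] the kind [o] changes no kind along a list avoiding [k], so the
   extra derivative becomes the head of a list of length [p.+1], where [perm_f] applies. *)
pose w' j := if j == k then o else w j.
have E l0 : k \notin l0 ->
    lattice_deriv o k (seq_deriv w l0 f) = seq_deriv w' (k :: l0) f.
  move=> kl0; rewrite /= {1}/w' eqxx; congr lattice_deriv.
  by apply: eq_seq_deriv => j jl; rewrite /w'; case: eqP jl kl0 => // -> ->.
rewrite !E -?(perm_mem pl) //; apply: perm_f; rewrite /= ?kl ?sl //.
by rewrite perm_cons.
Qed.

Lemma seq_deriv_swap w l k k' l' :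
  uniq (l ++ k :: k' :: l') -> size (l ++ k :: k' :: l') = p ->
  seq_deriv w (l ++ k :: k' :: l') f =1 seq_deriv w (l ++ k' :: k :: l') f.
Proof.
move=> u sz.
have pl : perm_eq (l ++ k :: k' :: l') (l ++ k' :: k :: l').
  by rewrite perm_cat2l; apply/permEl/(perm_catCA [:: k] [:: k']).
have kk' : k != k'.
  by move: u; rewrite cat_uniq => /and3P[_ _ /=]; rewrite inE; case: eqP.
have [le|le] :=
  lattice_deriv_comparable (w k) (w k') (seq_deriv w l' f) kk'.
  by apply: seq_deriv_eq_of_le => // x; rewrite !seq_deriv_cat seq_deriv_mono.
(* The comparison goes the other way here, so the hypotheses are transported to the swapped list. *)
apply/fsym/seq_deriv_eq_of_le.
- by rewrite -(perm_uniq pl).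
- by rewrite -(perm_size pl).
- by rewrite perm_sym.
- by move=> x; rewrite !seq_deriv_cat seq_deriv_mono.
Qed.

(** [k] passes the entries of [u] by adjacent swaps; the prefix [l] is general in the induction
    because each entry passed joins it. *)
Lemma seq_deriv_move w l k u v :
  uniq (l ++ k :: u ++ v) -> size (l ++ k :: u ++ v) = p ->
  seq_deriv w (l ++ k :: u ++ v) f =1 seq_deriv w (l ++ u ++ k :: v) f.
Proof.
elim: u l => // j u IH l ul sl x /=; rewrite seq_deriv_swap //.
have pl : perm_eq (l ++ k :: j :: u ++ v) (rcons l j ++ k :: u ++ v).
  by rewrite cat_rcons perm_cat2l; apply/permEl/(perm_catCA [:: k] [:: j]).
by rewrite -!(cat_rcons j) IH // -?(perm_uniq pl) -?(perm_size pl).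
Qed.

Lemma seq_permutable_pred : seq_permutable p f.
Proof.
move=> w l1 l2; rewrite -[l1]cat0s -[l2]cat0s.
(* The empty prefix is generalised to a common prefix [l] on which both lists already agree. The
   head [k] of [l1] is located in the other list, moved to its front, and absorbed into [l]. *)
elim: l1 l2 [::] => [|k l1 IH] l2 l ul sl.
  by rewrite perm_cat2l perm_sym => /perm_nilP ->.
rewrite perm_cat2l => pl.
have kl2 : k \in l2 by rewrite -(perm_mem pl) mem_head.
case/splitPr: kl2 pl => u v pl.
have pl1 : perm_eq l1 (u ++ v).
  rewrite -(perm_cons k) (perm_trans pl) //.
  exact/permEl/(perm_catCA u [:: k]).
have pl2 : perm_eq (l ++ k :: l1) (l ++ k :: u ++ v) by rewrite perm_cat2l perm_cons.
move=> x; rewrite -seq_deriv_move -?(perm_uniq pl2) -?(perm_size pl2) //.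
by rewrite -!(cat_rcons k); apply: IH; rewrite ?cat_rcons.
Qed.

End Step.

End SeqDerivatives.

Theorem theorem23 (R : realType) (n p : nat) (hp : (1 <= p)%N) (hpn : (p < n)%N)
    (f : cube n -> R) :
  permutable_lattice_derivs p.+1 f -> permutable_lattice_derivs p f.
Proof.
by rewrite !permutable_lattice_derivsP; apply: seq_permutable_pred.
Qed.
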